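(* Let $K$ be a field, $S=K[x_1,\ldots,x_n]$, $\mathfrak m=(x_1,\ldots,x_n)$, let $\mathbf c=(c_1,\ldots,c_n)$ be an integer vector with all $c_i\ge 0$, and put $\mathbf e=(1,1,\ldots,1)\in\mathbb Z^n$. Let $I\subset S$ be a non-zero $\mathbf c$-bounded stable ideal generated in degree $d$. Then $I:\mathfrak m=I+J$, where $J$ is a $(\mathbf c-\mathbf e)$-bounded ideal generated in degree $d-1$; indeed, \[ J=\bigl(u/x_n:\ u\in G(I),\ x_n\mid u \text{ and } \operatorname{Deg}(u/x_n)\leq \mathbf c-\mathbf e\bigr). \] Moreover, if $I$ is a $\mathbf c$-bounded strongly stable ideal, then $J$ is a $(\mathbf c-\mathbf e)$-bounded strongly stable ideal.
   Context: For a monomial ideal $I$, $G(I)$ is its unique minimal set of monomial generators. For a monomial $u=x_1^{a_1}\cdots x_n^{a_n}$ put $\operatorname{Deg}(u)=(a_1,\ldots,a_n)$ and $m(u)=\max\{i: a_i\neq 0\}$. Integer vectors are compared componentwise. For an integer vector $\mathbf b$, a monomial $u$ is $\mathbf b$-bounded if $\operatorname{Deg}(u)\le \mathbf b$ (so there are no $\mathbf b$-bounded monomials if some $b_i<0$); a monomial ideal is $\mathbf b$-bounded if all elements of $G(I)$ are $\mathbf b$-bounded. A $\mathbf b$-bounded monomial ideal $I$ is $\mathbf b$-bounded stable if for all $u\in G(I)$ and all $i<m(u)$ for which $x_iu/x_{m(u)}$ is $\mathbf b$-bounded, one has $x_iu/x_{m(u)}\in I$. It is $\mathbf b$-bounded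 strongly stable if for all $u\in G(I)$ and all $i<j$ with $x_j\mid u$ for which $x_iu/x_j$ is $\mathbf b$-bounded, one has $x_iu/x_j\in I$. An ideal is generated in degree $d$ if all its minimal monomial generators have degree $d$; the zero ideal vacuously satisfies these boundedness, stability and degree conditions. *)

(* Defs.v *)
From mathcomp Require Export all_boot all_order all_algebra.
From mathcomp.multinomials Require Export mpoly.
From Stdlib Require Import Classical_Prop.

Set Implicit Arguments.
Unset Strict Implicit.
Unset Printing Implicit Defensive.

Import Order.TTheory GRing.Theory Num.Theory.
Local Open Scope ring_scope.

(* Ideals are represented by their Prop-valued membership predicates;
   equality of ideals is stated extensionally. *)
Section Ideals.
Variable R : comNzRingType.
Implicit Types X I J : R -> Prop.

Definition ideal_gen X : R -> Prop := fun p =>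
  exists s : seq (R * R),
    (forall t, t \in s -> X t.2) /\ p = \sum_(t <- s) t.1 * t.2.

Definition ideal_sum I J : R -> Prop := fun p =>
  exists f g, I f /\ J g /\ p = f + g.

Definition ideal_colon I J : R -> Prop := fun p =>
  forall q, J q -> I (p * q).

End Ideals.

Section MonomialIdeals.
Variables (K : fieldType) (n : nat).
Implicit Types (I : {mpoly K[n]} -> Prop) (A : 'X_{1..n} -> Prop).
Implicit Types (u v w : 'X_{1..n}) (b : 'rV[int]_n).

Definition maximal_ideal : {mpoly K[n]} -> Prop :=
  ideal_gen (fun p => exists i : 'I_n, p = 'X_i).

Definition mon_ideal_gen A : {mpoly K[n]} -> Prop :=
  ideal_gen (fun p => exists u, A u /\ p = 'X_[u]).

Definition generates A I : Prop := forall p, I p <-> mon_ideal_gen A p.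

Definition monomial_ideal I : Prop := exists A, generates A I.

Definition minimal_generators A I : Prop :=
  generates A I /\
  forall B : 'X_{1..n} -> Prop,
    (forall u, B u -> A u) -> generates B I -> forall u, A u -> B u.

(* G(I), as a predicate on exponent vectors.  By [mingens_minimal] and
   [mingens_unique] below, for a monomial ideal this is the unique minimal
   set of monomial generators. *)
Definition mingens I : 'X_{1..n} -> Prop := fun u =>
  exists A, minimal_generators A I /\ A u.

Definition generated_in_degree (d : int) I : Prop :=
  forall u, mingens I u -> (mdeg u)%:Z = d.

(* Entries of b may be negative, in which case no monomial is bounded. *)
Definition bounded_mon b u : bool := [forall i, (u i)%:Z <= b ord0 i].

Definition bounded_ideal b I : Prop :=
  monomial_ideal I /\ forall u, mingens I u -> bounded_mon b u.

(* On exponent vectors, [exchange u i j] is x_i u / x_j; subtraction of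
   exponents is truncated, so this is only meaningful when x_j divides u. *)
Definition exchange u (i j : 'I_n) : 'X_{1..n} := (U_(i) + (u - U_(j)))%MM.

Definition bounded_strongly_stable b I : Prop :=
  bounded_ideal b I /\
  forall u (i j : 'I_n), mingens I u -> (i < j)%N -> u j != 0%N ->
    bounded_mon b (exchange u i j) -> I 'X_[exchange u i j].

Lemma mon_ideal_gen_sub A (p : {mpoly K[n]}) w :
  mon_ideal_gen A p -> w \in msupp p -> exists u, A u /\ (u <= w)%MM.
Proof.
case=> s [As ->] /msupp_sum_le; rewrite filter_predT => /flattenP [l].
case/mapP=> t ts -> /msuppM_le /allpairsP [[v v'] /= [_ + ->]].
case: (As t ts) => u [Au ->] /mem_msuppXP <-.
by exists u; split=> //; apply: lem_addl.
Qed.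

Lemma mon_ideal_genP A w :
  mon_ideal_gen A 'X_[w] <-> exists u, A u /\ (u <= w)%MM.
Proof.
split=> [/mon_ideal_gen_sub H | [u [Au uw]]].
  by apply: H; rewrite msuppX inE.
exists [:: ('X_[w - u], 'X_[u])]; split.
  by move=> t; rewrite inE => /eqP -> /=; exists u.
by rewrite big_seq1 /= -mpolyXD submK.
Qed.

Lemma mon_ideal_gen_supp A (p : {mpoly K[n]}) :
  mon_ideal_gen A p <->
  (forall w, w \in msupp p -> exists u, A u /\ (u <= w)%MM).
Proof.
split=> [Ap w|]; first exact: mon_ideal_gen_sub.
rewrite [X in mon_ideal_gen A X]mpolyE.
elim: (msupp p) => [|m s IH] H.
  by exists [::]; rewrite !big_nil.
rewrite big_cons; have [u [Au um]] := H m (mem_head _ _).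
have [|t [At ->]] := IH; first by move=> w ws; apply: H; rewrite inE ws orbT.
exists ((p@_m *: 'X_[m - u], 'X_[u]) :: t); split.
  move=> x; rewrite inE => /orP [/eqP -> /=|]; last exact: At.
  by exists u.
by rewrite big_cons /= -scalerAl -mpolyXD submK.
Qed.

Definition div_minimal I u : Prop :=
  I 'X_[u] /\ forall v, I 'X_[v] -> (v <= u)%MM -> v = u.

Lemma minimal_generatorsE A I :
  minimal_generators A I -> forall u, A u <-> div_minimal I u.
Proof.
move=> [genA minA] u; split=> [Au | [/genA /mon_ideal_genP [v [Av vu]] minu]].
  split; first by apply/genA/mon_ideal_genP; exists u; rewrite lepm_refl.
  move=> v /genA /mon_ideal_genP [w [Aw wv]] vu.
  have [wu|wu] := eqVneq w u.
    by apply/mnmP=> i; apply/eqP; rewrite eqn_leq (mnm_lepP vu) -{1}wu (mnm_lepP wv).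
  have /(_ u Au) : forall x, A x -> A x /\ x != u.
    apply: minA => [x [] //|p]; split=> [/genA|] /mon_ideal_gen_supp H; last first.
      apply/genA/mon_ideal_gen_supp=> x /H [y [[Ay _] yx]].
      by exists y.
    apply/mon_ideal_gen_supp=> x /H [y [Ay yx]].
    have [yu|yu] := eqVneq y u; last by exists y.
    exists w; split=> //; apply: lepm_trans wv _; apply: lepm_trans vu _.
    by rewrite -yu.
  by rewrite eqxx => -[].
rewrite -(minu v) //; apply/genA/mon_ideal_genP.
by exists v; rewrite lepm_refl.
Qed.

Lemma mingens_unique A I :
  minimal_generators A I -> forall u, A u <-> mingens I u.
Proof.
move=> minA u; split=> [Au|[B [minB Bu]]]; first by exists A.
by apply/(minimal_generatorsE minA)/(minimal_generatorsE minB).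
Qed.

Lemma div_minimal_minimal I :
  monomial_ideal I -> minimal_generators (div_minimal I) I.
Proof.
move=> [A genA].
have IX u v : I 'X_[u] -> (u <= v)%MM -> I 'X_[v].
  move=> /genA/mon_ideal_genP [w [Aw wu]] uv; apply/genA/mon_ideal_genP.
  by exists w; split=> //; apply: lepm_trans uv.
have exmin k w : (mdeg w < k)%N -> I 'X_[w] ->
    exists u, div_minimal I u /\ (u <= w)%MM.
  elim: k w => // k IH w wk Iw.
  have [[v [Iv [vw nvw]]]|nov] :=
    classic (exists v, I 'X_[v] /\ (v <= w)%MM /\ v != w).
    have [|u [mu uv]] := IH v _ Iv; last first.
      by exists u; split=> //; apply: lepm_trans vw.
    rewrite -ltnS; apply: leq_trans wk; rewrite ltnS -(submK vw) mdegD.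
    rewrite -[X in (X < _)%N]add0n ltn_add2r lt0n mdeg_eq0.
    apply: contraNneq nvw => dvw; apply/eqP/mnmP => i.
    by rewrite -[in RHS](submK vw) dvw mnmDE mnm0E.
  exists w; split; last exact: lepm_refl.
  split=> // v Iv vw; apply/eqP/negPn/negP => nvw.
  by case: nov; exists v.
split=> [p|B subB genB u [Iu minu]].
  split=> [/genA/mon_ideal_gen_supp H|/mon_ideal_gen_supp H].
    apply/mon_ideal_gen_supp => w /H wA.
    by apply: (exmin (mdeg w).+1) => //; apply/genA/mon_ideal_genP.
  apply/genA/mon_ideal_gen_supp => w /H [u [[Iu _] uw]].
  by apply/mon_ideal_genP/genA; apply: IX uw.
have /genB/mon_ideal_genP [v [Bv vu]] := Iu.
by rewrite -(minu v) //; have [] := subB v Bv.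
Qed.

Lemma mingens_minimal I :
  monomial_ideal I -> minimal_generators (mingens I) I.
Proof.
move=> /div_minimal_minimal minD; have DE := mingens_unique minD.
have [genD mD] := minD; split=> [p|B subB genB u /DE Du].
  split=> [/genD|] /mon_ideal_gen_supp H.
    by apply/mon_ideal_gen_supp => w /H [u [/DE Du uw]]; exists u.
  by apply/genD/mon_ideal_gen_supp => w /H [u [/DE Du uw]]; exists u.
by apply: (mD B) => // v /subB /DE.
Qed.

End MonomialIdeals.

(* m(u) for u <> 1; the junk value for u = 1 is the first variable, so that
   no index i satisfies i < m(u). *)
Definition maxvar n (u : 'X_{1..n.+1}) : 'I_n.+1 :=
  [arg max_(i > ord0 | u i != 0%N) (i : nat)].

Lemma maxvarP n (u : 'X_{1..n.+1}) : u != 0%MM ->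
  u (maxvar u) != 0%N /\ forall i, u i != 0%N -> (i <= maxvar u)%N.
Proof.
move=> u0; rewrite /maxvar; have [i ui] : exists i, u i != 0%N.
  apply/existsP; apply: contraNT u0 => /existsPn H.
  by apply/eqP/mnmP => i; rewrite mnm0E; apply/eqP; move: (H i); rewrite negbK.
case: (boolP (u ord0 != 0%N)) => [u00|]; first by case: arg_maxnP.
move=> /negPn u00; rewrite /arg_max /extremum; case: pickP => [k|noex] /=.
  by case/andP=> uk /forall_inP H; split.
case: (arg_maxnP (P := fun i => u i != 0%N) (fun i : 'I_n.+1 => i : nat) ui) => k uk H.
have := noex k; rewrite /= uk /=; move/negbT/forallPn => [j].
by rewrite negb_imply => /andP [/H /= ->].
Qed.

Lemma maxvar0 n : maxvar (0%MM : 'X_{1..n.+1}) = ord0.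
Proof.
rewrite /maxvar /arg_max /extremum; case: pickP => [k|] //=.
by rewrite mnm0E eqxx.
Qed.

Definition bounded_stable (K : fieldType) n (b : 'rV[int]_n.+1)
    (I : {mpoly K[n.+1]} -> Prop) : Prop :=
  bounded_ideal b I /\
  forall u (i : 'I_n.+1), mingens I u -> (i < maxvar u)%N ->
    bounded_mon b (exchange u i (maxvar u)) -> I 'X_[exchange u i (maxvar u)].

(* The ideal J; in {mpoly K[n.+1]} the last variable x_n has index
   [ord_max]. *)
Definition last_quotient_ideal (K : fieldType) n (b : 'rV[int]_n.+1)
    (I : {mpoly K[n.+1]} -> Prop) : {mpoly K[n.+1]} -> Prop :=
  mon_ideal_gen (fun v => exists u, mingens I u /\ u ord_max != 0%N /\
    v = (u - U_(ord_max))%MM /\ bounded_mon b v).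

(* Main.v *)
(** Let w be a monomial of I : m outside I.  For each i the monomial x_i w is
    divisible by some u in G(I) that does not divide w, so that u and x_i w
    have the same x_i-exponent; as u is c-bounded, w is (c - e)-bounded.  For
    i = n moreover x_n divides u and u/x_n divides w, so w lies in J.
    Stability only serves for the inclusion of m J in I.  Since J is generated
    by monomials of the same degree d - 1, its given generators are minimal,
    and strong stability transfers through x_i (u/x_n) / x_j = (x_i u/x_j) / x_n. *)
Require Import Defs.
From Stdlib Require Import Classical_Prop.
Import Order.TTheory GRing.Theory Num.Theory.
From mathcomp Require Import zify.
Local Open Scope ring_scope.

Set Implicit Arguments.
Unset Strict Implicit.
Unset Printing Implicit Defensive.

Section IdealGen.
Variable R : comNzRingType.
Implicit Types (X Y Z : R -> Prop) (p q : R).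

Lemma ideal_gen_mem X p : X p -> ideal_gen X p.
Proof.
move=> Xp; exists [:: (1, p)]; split; last by rewrite big_seq1 mul1r.
by move=> t; rewrite inE => /eqP ->.
Qed.

Lemma ideal_gen0 X : ideal_gen X 0.
Proof. by exists [::]; rewrite big_nil. Qed.

Lemma ideal_genD X p q : ideal_gen X p -> ideal_gen X q -> ideal_gen X (p + q).
Proof.
move=> [s [Xs ->]] [t [Xt ->]]; exists (s ++ t); rewrite big_cat; split=> // x.
by rewrite mem_cat => /orP [/Xs|/Xt].
Qed.

Lemma ideal_genMl X p q : ideal_gen X q -> ideal_gen X (p * q).
Proof.
move=> [s [Xs ->]]; exists [seq (p * t.1, t.2) | t <- s]; split.
  by move=> _ /mapP [t /Xs Xt ->].
by rewrite big_map mulr_sumr; apply: eq_bigr => t _; rewrite mulrA.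
Qed.

Lemma ideal_gen_sum X (T : eqType) (s : seq T) (F : T -> R) :
  (forall t, t \in s -> ideal_gen X (F t)) -> ideal_gen X (\sum_(t <- s) F t).
Proof.
move=> XF; rewrite big_seq.
apply: (big_ind (ideal_gen X)) => //; [exact: ideal_gen0 | exact: ideal_genD].
Qed.

(** Expanding both sums leaves only products of generators to check; this gives $J\mathfrak
    m\subseteq I$ below. *)
Lemma ideal_gen_mul X Y Z p q :
  (forall x y, X x -> Y y -> ideal_gen Z (x * y)) ->
  ideal_gen X p -> ideal_gen Y q -> ideal_gen Z (p * q).
Proof.
move=> XYZ [s [Xs ->]] [t [Yt ->]]; rewrite mulr_suml.
apply: ideal_gen_sum => a /Xs Xa; rewrite mulr_sumr.
apply: ideal_gen_sum => b /Yt Yb; rewrite mulrACA.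
by apply: ideal_genMl; apply: XYZ.
Qed.

End IdealGen.

Section MonomialIdealTheory.
Variables (K : fieldType) (n : nat).
Implicit Types (I : {mpoly K[n]} -> Prop) (A : 'X_{1..n} -> Prop).
Implicit Types (u v w : 'X_{1..n}) (f : {mpoly K[n]}) (b : 'rV[int]_n).

Lemma bounded_monP b u : reflect (forall i, (u i)%:Z <= b ord0 i) (bounded_mon b u).
Proof. exact: forallP. Qed.

Lemma lem_mdeg_eq u v : (u <= v)%MM -> mdeg u = mdeg v -> u = v.
Proof.
move=> uv duv; have := mdegD (v - u) u; rewrite submK // -duv => dvu.
have /eqP : mdeg (v - u) = 0%N by lia.
by rewrite mdeg_eq0 => /eqP vu0; rewrite -[RHS](submK uv) vu0 add0m.
Qed.

Lemma mingens_monP I w : monomial_ideal I ->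
  I 'X_[w] <-> exists u, mingens I u /\ (u <= w)%MM.
Proof.
move=> /mingens_minimal [genG _]; split; first by move/genG/mon_ideal_genP.
by move=> H; apply/genG/mon_ideal_genP.
Qed.

(** Some [u] in [A] divides [v], and minimality of [v] forces [u = v]. Properties of the listed
    generators of $J$ thus pass to $G(J)$. *)
Lemma mingens_mon_ideal_gen A v : mingens (mon_ideal_gen (K := K) A) v -> A v.
Proof.
move=> [B [minB /(minimal_generatorsE minB) [/mon_ideal_genP [u [Au uv]] minv]]].
by rewrite -(minv u) //; apply/mon_ideal_genP; exists u; rewrite lepm_refl.
Qed.

(** A minimal generator dividing [w] has the same degree as [w], hence equals it. *)
Lemma mingens_mem_degree I d w : monomial_ideal I -> generated_in_degree d I ->
  I 'X_[w] -> (mdeg w)%:Z = d -> mingens I w.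
Proof.
move=> monI degI /(mingens_monP _ monI) [u [Gu uw]] dw.
suff <- : u = w by [].
by apply: lem_mdeg_eq uw _; have := degI u Gu; lia.
Qed.

Lemma monomial_ideal_msupp I f : monomial_ideal I ->
  I f <-> forall w, w \in msupp f -> I 'X_[w].
Proof.
move=> [A genA]; split=> [/genA/mon_ideal_gen_supp H w /H ?|H].
  exact/genA/mon_ideal_genP.
by apply/genA/mon_ideal_gen_supp => w /H /genA/mon_ideal_genP.
Qed.

(** Multiplication by $x_i$ shifts the support of [f] without cancellation, so the colon can be
    tested monomial by monomial. *)
Lemma ideal_colon_maximal_msupp I f w (i : 'I_n) : monomial_ideal I ->
  ideal_colon I (@maximal_ideal K n) f -> w \in msupp f -> I 'X_[U_(i) + w].
Proof.
move=> monI fI wf.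
have: I (f * 'X_i) by apply: fI; apply: ideal_gen_mem; exists i.
move/(monomial_ideal_msupp _ monI); apply.
by rewrite (perm_mem (msuppMX f U_(i)%MM)); apply: map_f.
Qed.

Lemma mon_ideal_sum_msupp A1 A2 f :
  (forall w, w \in msupp f ->
     mon_ideal_gen (K := K) A1 'X_[w] \/ mon_ideal_gen (K := K) A2 'X_[w]) ->
  ideal_sum (mon_ideal_gen A1) (mon_ideal_gen A2) f.
Proof.
rewrite [X in ideal_sum _ _ X]mpolyE; elim: (msupp f) => [|m s IH] H.
  by exists 0, 0; rewrite big_nil addr0; do !split; apply: ideal_gen0.
rewrite big_cons -mul_mpolyC.
have [|g [h [Ig [Jh ->]]]] := IH; first by move=> w ws; apply: H; rewrite inE ws orbT.
case: (H m (mem_head _ _)) => /(ideal_genMl (f@_m)%:MP) Hm.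
  by exists ((f@_m)%:MP * 'X_[m] + g), h; rewrite addrA; do !split=> //; apply: ideal_genD.
exists g, ((f@_m)%:MP * 'X_[m] + h); rewrite addrCA.
by do !split=> //; apply: ideal_genD.
Qed.

(* The generator g of I below x_i w does not divide w, hence g_i = w_i + 1. *)
Lemma mingens_socle I w (i : 'I_n) : monomial_ideal I ->
  ~ I 'X_[w] -> I 'X_[U_(i) + w] ->
  exists g, [/\ mingens I g, (g <= U_(i) + w)%MM & g i = (w i).+1].
Proof.
move=> monI nIw /(mingens_monP _ monI) [g [Gg gw]]; exists g; split=> //.
have := mnm_lepP gw i; rewrite mnmDE mnm1E eqxx add1n leq_eqVlt => /orP [/eqP //|gi].
case: nIw; apply/(mingens_monP _ monI); exists g; split=> //; apply/mnm_lepP => k.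
have := mnm_lepP gw k; rewrite mnmDE mnm1E.
by have [<-|_] := eqVneq i k.
Qed.

End MonomialIdealTheory.

Lemma maxvar_ord_max n (u : 'X_{1..n.+1}) : u ord_max != 0%N -> maxvar u = ord_max.
Proof.
move=> un; have /maxvarP [_ maxu] : u != 0%MM.
  by apply: contraNneq un => ->; rewrite mnm0E.
by apply/val_inj/anti_leq; rewrite maxu // andbT -ltnS ltn_ord.
Qed.

Lemma bounded_mon_subr1P n (c : 'rV[int]_n) (u : 'X_{1..n}) :
  reflect (forall i, ((u i).+1)%:Z <= c ord0 i) (bounded_mon (c - const_mx 1) u).
Proof.
apply: (iffP (bounded_monP _ _)) => H i; have := H i; rewrite !mxE;
  by move: (c ord0 i) (u i) => a b; lia.
Qed.

Theorem theorem1p5 (K : fieldType) (n : nat) (c : 'rV[int]_n.+1)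
    (I : {mpoly K[n.+1]} -> Prop) (d : int)
    (c_ge0 : forall i, 0 <= c ord0 i)
    (I_neq0 : exists f, I f /\ f != 0)
    (I_stable : bounded_stable c I)
    (I_deg : generated_in_degree d I) :
  let e : 'rV[int]_n.+1 := const_mx 1 in
  let J := last_quotient_ideal (c - e) I in
  (forall f, ideal_colon I (@maximal_ideal K n.+1) f <-> ideal_sum I J f) /\
  bounded_ideal (c - e) J /\
  generated_in_degree (d - 1) J /\
  (bounded_strongly_stable c I -> bounded_strongly_stable (c - e) J).
Proof.
move=> e J; have [[monI Gc] stI] := I_stable.
have [genG _] := mingens_minimal monI.
have boundJ : bounded_ideal (c - e) J.
  split; first by eexists => p; apply: iff_refl.
  by move=> v /mingens_mon_ideal_gen [u [_ [_ []]]].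
split; [move=> f; split | do 2!split=> //].
- move=> fI.
  suff [g [h [Ig [Jh ->]]]] : ideal_sum (mon_ideal_gen (mingens I)) J f.
    by exists g, h; do !split=> //; apply/genG.
  apply: mon_ideal_sum_msupp => w wf.
  have [Iw|nIw] := classic (I 'X_[w]); first by left; apply/genG.
  have soc i := mingens_socle monI nIw (ideal_colon_maximal_msupp i monI fI wf).
  have [u [Gu uw un]] := soc ord_max.
  have vw : (u - U_(ord_max) <= w)%MM.
    apply/mnm_lepP => k; have := mnm_lepP uw k.
    by rewrite mnmBE mnmDE mnm1E; case: (_ == k) => /=; lia.
  right; apply/mon_ideal_genP; exists (u - U_(ord_max))%MM; split=> //.
  exists u; do !split=> //; first by rewrite un.
  (* With $v=u/x_n$ and [g] depending on [i], the chain is $v_i+1\le w_i+1=g_i\le c_i$. *)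
  apply/bounded_mon_subr1P => i; have [g [/Gc/bounded_monP/(_ i) gc _ gi]] := soc i.
  by have := mnm_lepP vw i; lia.
- move=> [g [h [/genG Ig [Jh ->]]]] q mq; apply/genG; rewrite mulrDl.
  apply: ideal_genD; first by rewrite mulrC; apply: ideal_genMl.
  apply: ideal_gen_mul Jh mq => _ _ [_ [[u [Gu [un [-> bv]]]] ->]] [i ->].
  (* Since $x_n\mid u$, $m(u)=n$: for $i<n$ the product $x_i(u/x_n)$ is the exchange in the
     stability condition, and for $i=n$ it is $u$ itself. *)
  apply/genG; rewrite mulrC -mpolyXD -/(exchange u i ord_max).
  have [iltn|/negbTE ini] := boolP (i < @ord_max n)%N.
    rewrite -(maxvar_ord_max un); apply: stI; rewrite // maxvar_ord_max //.
    (* The bound $\mathbf c-\mathbf e$ on $u/x_n$ leaves room for the extra factor $x_i$. *)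
    move/bounded_mon_subr1P: bv => bv; apply/bounded_monP => k.
    by have := bv k; rewrite /exchange mnmDE mnm1E; case: (i == k) => /=; lia.
  have -> : i = ord_max by apply/val_inj => /=; have := ltn_ord i; move: ini => /=; lia.
  have -> : exchange u ord_max ord_max = u.
    by rewrite /exchange addmC submK // lep1mP.
  by apply/(mingens_monP _ monI); exists u; rewrite lepm_refl.
- move=> v /mingens_mon_ideal_gen [u [Gu [un [-> _]]]].
  have uK : (U_(ord_max) <= u)%MM by rewrite lep1mP.
  by have := I_deg u Gu; rewrite -{1}(submK uK) mdegD mdeg1; lia.
- move=> [_ sstI]; split=> // v i j /mingens_mon_ideal_gen [u [Gu [un [-> _]]]] ij vj.
  set w := exchange _ i j => /[dup] wb /bounded_mon_subr1P wc.
  have uj : u j != 0%N by apply: contraNneq vj => uj; rewrite mnmBE uj sub0n.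
  (* Truncated subtraction is harmless because $x_jx_n\mid u$; for $j=n$, [vj] says that $x_n^2\mid
     u$. *)
  have wE : exchange u i j = (w + U_(ord_max))%MM.
    apply/mnmP => k; rewrite /w /exchange !(mnmDE, mnmBE, mnm1E).
    move: vj; rewrite mnmBE mnm1E.
    have [->|_] := eqVneq j k; have [<-|_] := eqVneq ord_max k; lia.
  (* Strong stability only puts $x_iu/x_j$ in $I$; having degree $d$, it lies in $G(I)$, so its
     quotient [w] by $x_n$ is a listed generator of $J$. *)
  have Gw : mingens I (exchange u i j).
    apply: (mingens_mem_degree monI I_deg).
      apply: sstI => //; rewrite wE; apply/bounded_monP => k.
      by have := wc k; rewrite mnmDE mnm1E; case: (_ == k) => /=; lia.
    have uK : (U_(j) <= u)%MM by rewrite lep1mP.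
    by have := I_deg u Gu; rewrite -{1}(submK uK) /exchange !mdegD !mdeg1; lia.
  apply/mon_ideal_genP; exists w; split; last exact: lepm_refl.
  exists (exchange u i j); do !split=> //; rewrite wE ?addmK //.
  by rewrite mnmDE mnm1E eqxx addn1.
Qed.
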